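(* Let $G$ be a graph of order $n$. Then $\gamma_{B_2}(G)\le \lceil 4n/9\rceil$.
   Context: Graphs are finite, undirected, simple and connected; $d(u,v)$ denotes the graph distance. A dominating $2$-broadcast on a graph $G$ is a function $f\colon V(G)\to\{0,1,2\}$ such that for every $u\in V(G)$ there is a vertex $v\in V(G)$ with $f(v)\ge 1$ and $d(u,v)\le f(v)$. Its cost is $\omega(f)=\sum_{v\in V(G)} f(v)$, and $\gamma_{B_2}(G)$ is the minimum cost of a dominating $2$-broadcast on $G$. *)

(* Defs.v *)
From HB Require Import structures.
From mathcomp Require Import all_boot.

Set Implicit Arguments.
Unset Strict Implicit.
Unset Printing Implicit Defensive.

Section Broadcast.

Variables (T : finType) (e : rel T).

Definition walk_of_length (u v : T) (k : nat) : bool :=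
  [exists p : k.-tuple T, path e u p && (last u p == v)].

(* The least length of a walk from u to v.  Such a least length is always     *)
(* below #|T|, so the search range is exhaustive; when u and v lie in         *)
(* different components the value is #|T|, which is not used below since the  *)
(* graphs considered are connected.                                           *)
Definition dist (u v : T) : nat := find (walk_of_length u v) (iota 0 #|T|).

(* 'I_3 is the value set {0, 1, 2}. *)
Definition dominating_2broadcast (f : {ffun T -> 'I_3}) : bool :=
  [forall u, exists v, (1 <= f v) && (dist u v <= f v)].

Definition cost (f : {ffun T -> 'I_3}) : nat := \sum_(v : T) f v.

Definition all1_broadcast : {ffun T -> 'I_3} := [ffun=> inord 1].

(* The minimum is over a nonempty set: all1_broadcast is dominating, see      *)
(* all1_broadcast_dominating.                                                 *)
Definition gammaB2 : nat :=
  cost [arg min_(f < all1_broadcast | dominating_2broadcast f) cost f].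

Lemma dist0 u : dist u u = 0.
Proof.
rewrite /dist; case: #|T| (fintype0 u) => [/(_ erefl)//|n _ /=].
by case: ifP => // /existsP[]; exists [tuple]; rewrite /= eqxx.
Qed.

Lemma all1_broadcast_dominating : dominating_2broadcast all1_broadcast.
Proof.
by apply/forallP=> u; apply/existsP; exists u; rewrite ffunE inordK // dist0.
Qed.

End Broadcast.

(* Main.v *)
Require Import Defs.
From mathcomp Require Import all_boot all_order all_algebra.
From mathcomp Require Import zify.

Import GRing.Theory Num.Theory.

(** Fix a rooted spanning tree and cut it, from the leaves up, into pieces that
    can be dominated separately.  Broadcasts of different pieces can be merged at
    the sum of their costs, so a piece [D] is harmless as soon as it can be
    dominated at a cost of at most [4 * #|D| / 9]; call such a piece paid for.

    When a vertex [r] is reached, each subtree hanging from a child of [r] has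
    been cut into paid pieces and a remainder, which is empty or a connected
    piece containing that child.  The point is that only three nonempty
    remainders ever occur: a single vertex (a leaf of what is left), an edge, and
    a path on four vertices rooted at an inner vertex.  Indeed, if [a], [b] and
    [c] remainders of these kinds hang from [r], they form together with [r] a
    bundle of [1 + a + 2b + 4c] vertices, which is dominated
    - at cost 1 if [b = c = 0], by [r], or if [a = c = 0] and [b = 1], by the
      upper end of the edge;
    - at cost 2 if [c = 0], by [r], or if [b = 0] and [c = 1], by the root of the
      path;
    - at cost [2 + c] always, by giving 2 to [r], and 1 to the inner vertex of
      every path other than its root.
    By these costs the bundle is paid for, unless [(a, b, c)] is [(0, 0, 0)],
    [(1, 0, 0)] or [(1, 1, 0)], in which case it is itself one of the three
    remainders ([bundle_paid_or_residual]); hence the cutting goes on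
    ([rooted_split]).

    At the root of the whole tree, a last remainder of 1, 2 or 4 vertices costs
    1, 1 or 2, which exceeds 4/9 of its order by less than 1: this is absorbed by
    the ceiling. *)

Set Implicit Arguments.
Unset Strict Implicit.
Unset Printing Implicit Defensive.

Section TwoBroadcast.

Variables (T : finType) (e : rel T).
Hypothesis e_sym : symmetric e.

Implicit Types (r u v w : T) (R S X Y D : {set T}).

Lemma disjoint_setUl X Y S :
  [disjoint X :|: Y & S] = [disjoint X & S] && [disjoint Y & S].
Proof. by rewrite -!setI_eq0 setIUl setU_eq0. Qed.

Lemma disjoint_setUr S X Y :
  [disjoint S & X :|: Y] = [disjoint S & X] && [disjoint S & Y].
Proof. by rewrite -!setI_eq0 setIUr setU_eq0. Qed.

Lemma disjoint_set1r S v : [disjoint S & [set v]] = (v \notin S).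
Proof. by rewrite disjoint_sym disjoints1. Qed.

(** * Balls *)

(** The recursion steps from the centre, so that the ball around a neighbour of
    [v] is contained in the next ball around [v] by definition. *)
Fixpoint ball k v : {set T} :=
  if k is k'.+1 then \bigcup_(w | (w == v) || e w v) ball k' w else [set v].

Lemma ball_center k v : v \in ball k v.
Proof.
elim: k v => [|k IH] v /=; first by rewrite inE.
by apply/bigcupP; exists v; rewrite ?eqxx.
Qed.

Lemma sub_ballS k v : ball k v \subset ball k.+1 v.
Proof. by apply: (bigcup_max v); rewrite ?eqxx. Qed.

Lemma sub_ball_adj k v w : e v w -> ball k w \subset ball k.+1 v.
Proof. by move=> evw; apply: (bigcup_max w); rewrite // e_sym evw orbT. Qed.

Lemma adj_ball k v w : e v w -> w \in ball k.+1 v.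
Proof. by move=> /(sub_ball_adj k)/subsetP; apply; apply: ball_center. Qed.

Lemma ball_walk k u v :
  u \in ball k v -> exists2 j, j <= k & walk_of_length e u v j.
Proof.
elim: k v => [|k IH] v /=.
  by rewrite inE => /eqP->; exists 0 => //; apply/existsP; exists [tuple] => /=.
case/bigcupP=> w wv /IH [j lejk /existsP [p /andP [ep /eqP lp]]].
case/orP: wv => [/eqP wv|ewv].
  exists j; first exact: leqW.
  by apply/existsP; exists p; rewrite ep lp wv eqxx.
exists j.+1 => //; apply/existsP; exists [tuple of rcons p v].
by rewrite /= rcons_path ep lp ewv last_rcons eqxx.
Qed.

Arguments ball : simpl never.

Lemma walk_dist u v j : walk_of_length e u v j -> dist e u v <= j.
Proof.
move=> wj; rewrite leqNgt; apply/negP => ltj.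
have lejT : j < #|T|.
  by apply: leq_trans ltj _; rewrite -[leqRHS](size_iota 0); apply: find_size.
by have := before_find 0 ltj; rewrite nth_iota // add0n wj.
Qed.

Lemma ball_dist k u v : u \in ball k v -> dist e u v <= k.
Proof. by case/ball_walk => j lejk /walk_dist/leq_trans; apply. Qed.

(** * Dominating a set of vertices at a given cost *)

(** The broadcasting vertices may lie outside [X], which makes the notion
    monotone and subadditive in [X]. *)
Definition coverable X k :=
  exists2 f : {ffun T -> 'I_3}, cost f <= k
    & {in X, forall u, [exists v, (1 <= f v) && (dist e u v <= f v)]}.

Lemma coverable_sub X Y k : X \subset Y -> coverable Y k -> coverable X k.
Proof. by move=> /subsetP sXY [f cf domf]; exists f => // u /sXY/domf. Qed.

Lemma coverable0 : coverable set0 0.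
Proof.
exists [ffun=> ord0]; last by move=> u; rewrite inE.
by rewrite /cost big1 // => v _; rewrite ffunE.
Qed.

(** The pointwise maximum of two broadcasts dominates what either of them
    dominates. *)
Lemma coverableU X Y k l :
  coverable X k -> coverable Y l -> coverable (X :|: Y) (k + l).
Proof.
move=> [f cf domf] [g cg domg].
pose h := [ffun v => if f v <= g v then g v else f v].
have hE v : h v = maxn (f v) (g v) :> nat by rewrite ffunE; case: ifP; lia.
exists h.
  apply: leq_trans (leq_add cf cg); rewrite /cost -big_split /=.
  by apply: leq_sum => v _; rewrite hE; lia.
move=> u; rewrite inE => /orP [/domf|/domg] /existsP [v /andP [v1 v2]];
  by apply/existsP; exists v; rewrite hE; lia.
Qed.

Lemma coverable_ball k v : 0 < k <= 2 -> coverable (ball k v) k.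
Proof.
move=> /andP [k0 k2]; exists [ffun w => if w == v then inord k else ord0].
  rewrite /cost (bigD1 v) //= ffunE eqxx inordK // big1 ?addn0 // => w.
  by rewrite ffunE => /negPf->.
move=> u /ball_dist duv; apply/existsP; exists v.
by rewrite ffunE eqxx inordK // k0 duv.
Qed.

Definition paid D := exists2 k, coverable D k & 9 * k <= 4 * #|D|.

Lemma paidU D D' : [disjoint D & D'] -> paid D -> paid D' -> paid (D :|: D').
Proof.
move=> dDD [k ck lek] [l cl lel]; exists (k + l); first exact: coverableU.
by rewrite cardsU disjoint_setI0 // cards0; lia.
Qed.

(** * Bundles *)

(** The pieces that hang from the root of a bundle are bundles with the
    parameters of a vertex, of an edge, and of a path on four vertices rooted at
    an inner vertex; [a], [b] and [c] count them. *)
Inductive bundle : T -> {set T} -> nat -> nat -> nat -> Prop :=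
| bundle1 r : bundle r [set r] 0 0 0
| bundle_leaf r R a b c r' R' :
    bundle r R a b c -> bundle r' R' 0 0 0 -> e r r' -> [disjoint R & R'] ->
    bundle r (R :|: R') a.+1 b c
| bundle_edge r R a b c r' R' :
    bundle r R a b c -> bundle r' R' 1 0 0 -> e r r' -> [disjoint R & R'] ->
    bundle r (R :|: R') a b.+1 c
| bundle_path r R a b c r' R' :
    bundle r R a b c -> bundle r' R' 1 1 0 -> e r r' -> [disjoint R & R'] ->
    bundle r (R :|: R') a b c.+1.

Lemma card_bundle r R a b c :
  bundle r R a b c -> #|R| = 1 + a + 2 * b + 4 * c.
Proof.
by elim=> {r R a b c} [r|r R a b c r' R' _ IH _ IH' _ dR
    |r R a b c r' R' _ IH _ IH' _ dR|r R a b c r' R' _ IH _ IH' _ dR];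
  rewrite ?cards1 // cardsU disjoint_setI0 // cards0 IH IH'; lia.
Qed.

Lemma bundle0_set1 r R : bundle r R 0 0 0 -> R = [set r].
Proof. by move=> bR; inversion bR. Qed.

Lemma star_sub_ball1 r R a : bundle r R a 0 0 -> R \subset ball 1 r.
Proof.
elim: a R => [|a IH] R bR.
  by rewrite (bundle0_set1 bR) sub1set ball_center.
inversion bR; subst; rewrite subUset IH //.
by rewrite (bundle0_set1 H1) sub1set adj_ball.
Qed.

(** The second ball is centred at the upper end of the edge. *)
Lemma one_edge_sub_ball1U r R a :
  bundle r R a 1 0 -> exists v, R \subset ball 1 r :|: ball 1 v.
Proof.
elim: a R => [|a IH] R bR; inversion bR; subst.
- by exists r'; apply: setUSS; [exact: star_sub_ball1 H0 | exact: star_sub_ball1 H1].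
- have [v sRv] := IH _ H0; exists v; rewrite subUset sRv /=.
  by rewrite (bundle0_set1 H1) sub1set inE adj_ball.
- by exists r'; apply: setUSS; [exact: star_sub_ball1 H0 | exact: star_sub_ball1 H1].
Qed.

Lemma path3_sub_ball1 r R : bundle r R 0 1 0 -> exists v, R \subset ball 1 v.
Proof.
move=> bR; inversion bR; subst; exists r'.
rewrite subUset (star_sub_ball1 H1) andbT (bundle0_set1 H0) sub1set.
by rewrite adj_ball // e_sym.
Qed.

(** The set [X] consists of the balls of radius 1 around the inner vertices,
    other than the roots, of the paths hanging from [r]; every vertex outside
    them is at distance at most 2 from [r]. *)
Lemma bundle_sub_ball2U r R a b c :
  bundle r R a b c -> exists2 X, coverable X c & R \subset ball 2 r :|: X.
Proof.
elim=> {r R a b c} [r|r R a b c r' R' _ [X cX sX] b' _ err _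
    |r R a b c r' R' _ [X cX sX] b' _ err _
    |r R a b c r' R' _ [X cX sX] b' _ err _].
- by exists set0; [exact: coverable0 | rewrite sub1set inE ball_center].
- exists X => //; rewrite subUset sX (bundle0_set1 b') sub1set inE.
  by rewrite adj_ball.
- exists X => //; rewrite subUset sX /=; apply: subset_trans (subsetUl _ _).
  exact: subset_trans (star_sub_ball1 b') (sub_ball_adj 1 err).
have [v sRv] := one_edge_sub_ball1U b'.
exists (X :|: ball 1 v).
  by rewrite -[c.+1]addn1; apply: coverableU => //; apply: coverable_ball.
rewrite setUA subUset (subset_trans sX) ?subsetUl //=.
apply: subset_trans sRv _; apply: setUSS => //.
exact: subset_trans (sub_ball_adj 1 err) (subsetUl _ _).
Qed.

Lemma pathless_sub_ball2 r R a b : bundle r R a b 0 -> R \subset ball 2 r.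
Proof.
move c0: {1}0 => c bR; elim: bR c0 => {r R a b c} [r|r R a b c r' R' _ IH b' _ err _
    |r R a b c r' R' _ IH b' _ err _|//] c0.
- by rewrite sub1set ball_center.
- by rewrite subUset (IH c0) (bundle0_set1 b') sub1set adj_ball.
rewrite subUset (IH c0) /=.
exact: subset_trans (star_sub_ball1 b') (sub_ball_adj 1 err).
Qed.

(** The centre is the root of the path, at distance 2 from the leaves hanging
    from [r]. *)
Lemma one_path_sub_ball2 r R a :
  bundle r R a 0 1 -> exists2 v, e v r & R \subset ball 2 v.
Proof.
move b0: {1}0 => b; move c1: {1}1 => c bR.
elim: bR b0 c1 => {r R a b c} [//|r R a b c r' R' _ IH b' _ err _|//
    |r R a b c r' R' bR _ b' _ err _] b0 c1.
  have [v evr sRv] := IH b0 c1; exists v => //; rewrite subUset sRv /=.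
  rewrite (bundle0_set1 b') sub1set.
  by apply: (subsetP (sub_ball_adj 1 evr)); apply: adj_ball.
case: c1 => c1; subst b c; exists r'; first by rewrite e_sym.
rewrite subUset (pathless_sub_ball2 b') andbT.
by apply: subset_trans (star_sub_ball1 bR) (sub_ball_adj 1 _); rewrite e_sym.
Qed.

Lemma coverable_sub_ball X k v : 0 < k <= 2 -> X \subset ball k v -> coverable X k.
Proof. by move=> k02 /coverable_sub; apply; apply: coverable_ball. Qed.

Variant residual : nat -> nat -> nat -> Prop :=
| residual_vertex : residual 0 0 0
| residual_edge : residual 1 0 0
| residual_path : residual 1 1 0.

(** The general cost [2 + c] is enough when [c >= 2], or when [c = 1] and
    [b >= 1]; the tightest case, [b = c = 1] and [a = 0], has 7 vertices and gives
    [27 <= 28].  The case [c = 1], [b = 0] is apart, since a cost of 3 would be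
    too much for 5 or 6 vertices; so is [b = 1], [a = c = 0], since a cost of 2
    would be too much for 3 vertices. *)
Lemma bundle_paid_or_residual r R a b c :
  bundle r R a b c -> paid R \/ residual a b c.
Proof.
move=> bR; have cR := card_bundle bR.
case: c => [|c] in bR cR *; last first.
  have [/andP [/eqP b0 /eqP c0]|bc] := boolP ((b == 0) && (c == 0)).
    subst b c; have [v _ sRv] := one_path_sub_ball2 bR.
    by left; exists 2; [exact: coverable_sub_ball sRv | lia].
  left; exists (2 + c.+1); last by lia.
  have [X cX sRX] := bundle_sub_ball2U bR; apply: coverable_sub sRX _.
  by apply: coverableU => //; apply: coverable_ball.
case: b => [|b] in bR cR *.
  case: a => [|[|a]] in bR cR *; [right; constructor | right; constructor |].
  by left; exists 1; [exact: coverable_sub_ball (star_sub_ball1 bR) | lia].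
have cR2 := coverable_sub_ball (isT : 0 < 2 <= 2) (pathless_sub_ball2 bR).
case: b => [|b] in bR cR *; last by left; exists 2 => //; lia.
case: a => [|[|a]] in bR cR *; [|by right; constructor|by left; exists 2 => //; lia].
by have [v sRv] := path3_sub_ball1 bR; left; exists 1;
  [exact: coverable_sub_ball sRv | lia].
Qed.

(** * Cutting a rooted tree *)

(** [rooted r S] says that [S] is the vertex set of a subtree of the graph
    rooted at [r]: every such tree is obtained from single vertices by hanging
    one tree at the root of another. *)
Inductive rooted : T -> {set T} -> Prop :=
| rooted1 r : rooted r [set r]
| rooted_graft r S r' S' :
    rooted r S -> rooted r' S' -> e r r' -> [disjoint S & S'] ->
    rooted r (S :|: S').

Lemma rooted_root r S : rooted r S -> r \in S.
Proof. by elim=> {r S} [r|r S r' S' _ rS _ _ _ _]; rewrite ?inE ?rS ?eqxx. Qed.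

Lemma rooted_add_leaf r S u v :
  rooted r S -> u \in S -> v \notin S -> e u v -> rooted r (S :|: [set v]).
Proof.
move=> rS; elim: rS u => {r S} [r|r S r' S' rS IH rS' IH' err dS] u.
  rewrite !inE => /eqP-> nvr erv; apply: rooted_graft (rooted1 r) (rooted1 v) erv _.
  by rewrite disjoint_set1r inE.
rewrite !inE negb_or => uSS /andP [vS vS'] euv.
case/orP: uSS => [uS|uS']; last first.
  rewrite -setUA; apply: rooted_graft (IH' _ uS' vS' euv) err _ => //.
  by rewrite disjoint_setUr dS disjoint_set1r.
rewrite setUAC; apply: rooted_graft (IH _ uS vS euv) rS' err _.
by rewrite disjoint_setUl dS disjoints1.
Qed.

(** A connected graph has a spanning tree: an edge leaves the vertex set of a
    tree that is not spanning, and a leaf is added along it. *)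
Lemma rooted_setT r : (forall x y, connect e x y) -> rooted r [set: T].
Proof.
move=> conn; suff grow m S : #|~: S| <= m -> rooted r S -> rooted r [set: T].
  exact: grow (leqnn _) (rooted1 r).
elim: m S => [|m IH] S leS rS.
  have /eqP : ~: S == set0 by rewrite -cards_eq0; lia.
  by rewrite -setCT => /setC_inj <-.
have [/existsP [u /existsP [v /and3P [uS vS euv]]]|noedge] :=
    boolP [exists u, exists v, [&& u \in S, v \notin S & e u v]].
  apply: IH (rooted_add_leaf rS uS vS euv); rewrite setCU -setDE.
  by move: leS; rewrite (cardsD1 v) inE vS.
suff -> : [set: T] = S by [].
have clS : closed e (mem S).
  apply: intro_closed => [|x y exy xS]; first exact: symmetric_from_pre.
  apply: contraNT noedge => yS; apply/existsP; exists x; apply/existsP; exists y.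
  by rewrite xS yS exy.
apply/setP=> x; rewrite inE.
by rewrite -(closed_connect clS (conn r x)); have := rooted_root rS.
Qed.

(** By induction on grafts: what is left of the grafted tree is either paid for
    and discarded, or one of the residual bundles, which are exactly those that
    may hang from the root of a larger bundle. *)
Lemma rooted_split r S : rooted r S ->
  exists D R a b c,
    [/\ S = D :|: R, [disjoint D & R], paid D & bundle r R a b c].
Proof.
elim=> {r S} [r|r S r' S' _ [D [R [a [b [c [-> dDR pD bR]]]]]] _
    [D' [R' [a' [b' [c' [-> dDRp pD' bR']]]]]] err].
  exists set0, [set r], 0, 0, 0; split; rewrite ?set0U //.
  - by rewrite -setI_eq0 set0I.
  - by exists 0; [exact: coverable0 | rewrite cards0].
  exact: bundle1.
rewrite disjoint_setUl !disjoint_setUr.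
case/andP=> /andP [dDD' dDR'] /andP [dRD' dRR'].
have pDD' : paid (D :|: D') by apply: paidU.
have dDDR : [disjoint D :|: D' & R] by rewrite disjoint_setUl dDR disjoint_sym.
have dDDR' : [disjoint D :|: D' & R'] by rewrite disjoint_setUl dDR'.
case: (bundle_paid_or_residual bR') => [pR'|res].
  exists (D :|: D' :|: R'), R, a, b, c; split=> //; last exact: paidU.
    by rewrite setUACA (setUC R) setUA.
  by rewrite disjoint_setUl dDDR disjoint_sym.
have split_graft a1 b1 c1 : bundle r (R :|: R') a1 b1 c1 ->
    exists D0 R0 a0 b0 c0, [/\ D :|: R :|: (D' :|: R') = D0 :|: R0,
      [disjoint D0 & R0], paid D0 & bundle r R0 a0 b0 c0].
  exists (D :|: D'), (R :|: R'), a1, b1, c1; split=> //; first exact: setUACA.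
  by rewrite disjoint_setUr dDDR.
case: res bR' => bR'; apply: split_graft.
- exact: bundle_leaf bR bR' err dRR'.
- exact: bundle_edge bR bR' err dRR'.
exact: bundle_path bR bR' err dRR'.
Qed.

(** * The bound *)

(** The slack 8 is the most that rounding [4n/9] up can add to the numerator.
    A final remainder needs only 5, 1 or 2 of it: [9 - 4] for the vertex, [9 - 8]
    for the edge and [18 - 16] for the path. *)
Lemma coverable_setT :
  (forall x y, connect e x y) ->
  exists2 k, coverable [set: T] k & 9 * k <= 4 * #|T| + 8.
Proof.
move=> conn; case: (pickP (fun _ : T => true)) => [r _|T0]; last first.
  by exists 0 => //; apply: coverable_sub coverable0; apply/subsetP=> x; have := T0 x.
have [D [R [a [b [c [eDR dDR [k cD lek] bR]]]]]] := rooted_split (rooted_setT r conn).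
have cT : #|T| = #|D| + #|R|.
  by rewrite -cardsT eDR cardsU disjoint_setI0 // cards0 subn0.
have cR := card_bundle bR.
have extend l : coverable R l -> 9 * l <= 4 * #|R| + 8 ->
    exists2 k, coverable [set: T] k & 9 * k <= 4 * #|T| + 8.
  by exists (k + l); [rewrite eDR; apply: coverableU | lia].
case: (bundle_paid_or_residual bR) => [[l cl lel]|res].
  by apply: (extend l) => //; lia.
case: res bR cR => bR cR.
- by apply: (extend 1); [exact: coverable_sub_ball (star_sub_ball1 bR) | lia].
- by apply: (extend 1); [exact: coverable_sub_ball (star_sub_ball1 bR) | lia].
by apply: (extend 2); [exact: coverable_sub_ball (pathless_sub_ball2 bR) | lia].
Qed.

Lemma gammaB2_coverable k : coverable [set: T] k -> gammaB2 e <= k.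
Proof.
move=> [f cf domf]; apply: leq_trans cf; rewrite /gammaB2.
case: arg_minnP => [|g _ gmin]; first exact: all1_broadcast_dominating.
by apply: gmin; apply/forallP=> u; apply: domf; rewrite inE.
Qed.

End TwoBroadcast.

Lemma leq_ceil_4n9 (k n : nat) :
  9 * k <= 4 * n + 8 -> (k%:Z <= Num.ceil (4%:R * n%:R / 9%:R : rat))%R.
Proof.
move=> le9k; suff: (k%:Z - 1 < Num.ceil (4%:R * n%:R / 9%:R : rat))%R by lia.
rewrite ceil_gt_int ltr_pdivlMr // intrB mulrBl mul1r ltrBlDr.
by rewrite -[(_%:~R)%R]/(k%:R)%R -!natrM -natrD ltr_nat; lia.
Qed.

Theorem corollary1 (T : finType) (e : rel T) (n : nat)
    (e_sym : symmetric e) (e_irr : irreflexive e)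
    (e_conn : forall x y : T, connect e x y)
    (order_n : #|T| = n) :
  ((gammaB2 e)%:Z <= Num.ceil (4%:R * n%:R / 9%:R : rat))%R.
Proof.
have [k cT lek] := coverable_setT e_sym e_conn.
apply: leq_ceil_4n9; rewrite -order_n; apply: leq_trans lek.
by rewrite leq_mul2l gammaB2_coverable.
Qed.
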